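(* Let $H$ be any one of the four Hamiltonians $H^{L},H^{ON},H^{PH},H^{BP}:\overline\Omega\times\mathbb{R}\times\mathbb{R}^2\to\mathbb{R}$ defined in the context. Then $H$ satisfies the following two properties. (H1) For every $R>0$ there exists $\gamma_R>0$ such that $H(x,u,p)-H(x,v,p)\ge \gamma_R(u-v)$ for all $x\in\Omega$, all real $u,v$ with $-R\le v\le u\le R$, and all $p\in\mathbb{R}^2$. (H2) For every $R>0$ there exists a function $m_R$ with $m_R(t)\to 0$ as $t\to 0$ such that $|H(x,u,p)-H(y,u,p)|\le m_R\big(|x-y|(1+|p|)\big)$ for all $x,y\in\Omega$, all $-R\le u\le R$, and all $p\in\mathbb{R}^2$.
   Context: Let $\Omega\subset\mathbb{R}^2$ be a bounded open set and $f>0$ a constant. For $x\in\mathbb{R}^2$, $p\in\mathbb{R}^2$ put $$Q(x)=\frac{f}{\sqrt{f^2+|x|^2}},\qquad W(x,p)=\frac{f^2|p|^2+(p\cdot x)^2}{Q(x)^2}.$$ Constants: for the Oren-Nayar model, $\sigma\in[0,\pi/2)$, $A=1-0.5\,\sigma^2(\sigma^2+0.33)^{-1}$, $B=0.45\,\sigma^2(\sigma^2+0.09)^{-1}$; for the Phong and Blinn-Phong models, $k_A,k_D,k_S\ge 0$ with $k_A+k_D+k_S=1$ and $k_D>0$; $\alpha\ge1$ is an integer; $c\ge 1$ is a real number. Define on $[0,+\infty)$ $$F_L(r)=\sqrt{r+1},\qquad F_{ON}(r)=\frac{r+1}{A\sqrt{r+1}+Br},\qquad F_{BP}(r)=\frac{(r+1)^{c/2}}{k_D(r+1)^{\frac{c-1}{2}}+k_S},$$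 $$F_{PH}(r)=\begin{cases}\dfrac{\sqrt{r+1}}{k_D}& r\ge 1,\\[2mm] \dfrac{(r+1)^{\alpha+1/2}}{k_D(r+1)^{\alpha}+k_S(r+1)^{1/2}(1-r)^{\alpha}}& 0\le r<1.\end{cases}$$ Let $I,I_A:\overline\Omega\to\mathbb{R}$ be given functions (image intensity and ambient light component). For $M\in\{L,ON,PH,BP\}$ the Hamiltonian is $$H^{M}(x,r,p)=-e^{-2r}+\mathcal{I}(x)\,f^2\,F_M(W(x,p)),$$ where $\mathcal{I}=I$ if $M\in\{L,ON\}$ and $\mathcal{I}=I-k_AI_A$ if $M\in\{PH,BP\}$. Standing assumption: $\mathcal{I}$ is Lipschitz continuous in $\overline\Omega$, and there exist $\delta>0$ and a neighborhood $\Gamma$ of $\partial\Omega$ such that $\mathcal{I}(x)\ge\delta>0$ for $x\in\Gamma$ (i.e. for $x\in\Gamma\cap\overline\Omega$). *)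

(* Defs.v *)
From mathcomp Require Import all_boot all_order all_algebra.
From mathcomp Require Import all_classical all_reals all_analysis.

Set Implicit Arguments.
Unset Strict Implicit.
Unset Printing Implicit Defensive.

Import Order.TTheory GRing.Theory Num.Theory.
Import numFieldNormedType.Exports.

Local Open Scope classical_set_scope.
Local Open Scope ring_scope.

Section PlaneGeometry.
Context {R : realType}.
Implicit Types (x y p : 'rV[R]_2) (A : set 'rV[R]_2).

Definition dotv p x : R := \sum_(i < 2) p ord0 i * x ord0 i.

(* The library norm on row vectors is the maximum norm, which induces the same
   topology and the same bounded sets; every length below is Euclidean. *)
Definition enorm x : R := Num.sqrt (dotv x x).

Definition lipschitz_in A (g : 'rV[R]_2 -> R) : Prop :=
  exists2 L : R, 0 <= L &
    forall x y, A x -> A y -> `|g x - g y| <= L * enorm (x - y).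

Definition boundary A : set 'rV[R]_2 := closure A `\` interior A.

End PlaneGeometry.

Inductive model (R : realType) : Type :=
| Lambert
| OrenNayar of R                (* sigma *)
| Phong of R & R & R & nat      (* kA, kD, kS, alpha *)
| BlinnPhong of R & R & R & R.  (* kA, kD, kS, c *)

Arguments Lambert {R}.

Section Hamiltonians.
Context {R : realType}.
Implicit Types (M : model R) (f r : R) (x p : 'rV[R]_2).

Definition phong_weights (kA kD kS : R) : Prop :=
  [/\ 0 <= kA, 0 < kD, 0 <= kS & kA + kD + kS = 1].

Definition admissible M : Prop :=
  match M with
  | Lambert => True
  | OrenNayar sigma => 0 <= sigma < pi / 2
  | Phong kA kD kS alpha => phong_weights kA kD kS /\ (1 <= alpha)%N
  | BlinnPhong kA kD kS c => phong_weights kA kD kS /\ 1 <= c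
  end.

Definition ON_A (sigma : R) : R :=
  1 - (5 / 10) * sigma ^+ 2 * (sigma ^+ 2 + 33 / 100)^-1.

Definition ON_B (sigma : R) : R :=
  (45 / 100) * sigma ^+ 2 * (sigma ^+ 2 + 9 / 100)^-1.

(* Only the values at [r >= 0] are meaningful. *)
Definition F M r : R :=
  match M with
  | Lambert => Num.sqrt (r + 1)
  | OrenNayar sigma =>
      (r + 1) / (ON_A sigma * Num.sqrt (r + 1) + ON_B sigma * r)
  | Phong _ kD kS alpha =>
      if 1 <= r then Num.sqrt (r + 1) / kD
      else (r + 1) `^ (alpha%:R + 1 / 2)
           / (kD * (r + 1) ^+ alpha
              + kS * (r + 1) `^ (1 / 2) * (1 - r) ^+ alpha)
  | BlinnPhong _ kD kS c =>
      (r + 1) `^ (c / 2) / (kD * (r + 1) `^ ((c - 1) / 2) + kS)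
  end.

Definition Q f x : R := f / Num.sqrt (f ^+ 2 + enorm x ^+ 2).

Definition W f x p : R :=
  (f ^+ 2 * enorm p ^+ 2 + dotv p x ^+ 2) / Q f x ^+ 2.

Definition eff_intensity M (I IA : 'rV[R]_2 -> R) x : R :=
  match M with
  | Lambert | OrenNayar _ => I x
  | Phong kA _ _ _ | BlinnPhong kA _ _ _ => I x - kA * IA x
  end.

Definition hamiltonian M f (I IA : 'rV[R]_2 -> R) x (u : R) p : R :=
  - expR (- (2 * u)) + eff_intensity M I IA x * f ^+ 2 * F M (W f x p).

End Hamiltonians.

Section StructureConditions.
Context {R : realType}.
Variables (Omega : set 'rV[R]_2) (H : 'rV[R]_2 -> R -> 'rV[R]_2 -> R).

Definition H1 : Prop :=
  forall rho : R, 0 < rho ->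
  exists2 gamma : R, 0 < gamma &
    forall x (u v : R) p, Omega x -> - rho <= v -> v <= u -> u <= rho ->
      gamma * (u - v) <= H x u p - H x v p.

(* The filter [t --> 0] is two-sided and contains 0 itself, so [m 0 = 0]. *)
Definition H2 : Prop :=
  forall rho : R, 0 < rho ->
  exists2 m : R -> R, m t @[t --> (0 : R)] --> (0 : R) &
    forall x y (u : R) p, Omega x -> Omega y -> - rho <= u -> u <= rho ->
      `|H x u p - H y u p| <= m (enorm (x - y) * (1 + enorm p)).

End StructureConditions.

(* Main.v *)
Require Import Defs.
From mathcomp Require Import all_boot all_order all_algebra.
From mathcomp Require Import all_classical all_reals all_analysis.
From mathcomp Require Import ring lra.

Set Implicit Arguments.
Unset Strict Implicit.
Unset Printing Implicit Defensive.

Import Order.TTheory GRing.Theory Num.Theory.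
Import numFieldNormedType.Exports.

Local Open Scope classical_set_scope.
Local Open Scope ring_scope.

(** The dependence on [u] is the term [- expR (- (2 * u))], whose derivative
    [2 * expR (- (2 * u))] is at least [2 * expR (- (2 * rho))] for [u <= rho];
    this gives [H1].

    For [H2] the modulus is linear, [m t = C * t], and the point is that the
    Hamiltonian is Lipschitz in [x] with a constant growing linearly in
    [enorm p].  An increment of [W] is quadratic in [p], and the excess power has
    to be recovered from the flattening of [F] at infinity; passing through
    [T = Num.sqrt (1 + W)] separates the two effects.

    - [W f x p] is quadratic in [p] and polynomial in [x], so over a bounded set
      its increments are at most [c * enorm p ^+ 2 * enorm (x - y)].  Since
      [T x - T y = (W x - W y) / (T x + T y)] and [T >= f * enorm p], dividing
      gains one power of [enorm p] ([secant_lipschitz]).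

    - In each of the four models [F M (T ^+ 2 - 1) = T / D T], where
      [D] is bounded below on [1 <= T] and has relative increments controlled by
      those of [T] ([slowly_varying]).  Such a quotient is Lipschitz and has
      linear growth ([slowly_varying_lipschitz], [slowly_varying_le]), whether
      [D] is constant (Lambert), tends to a limit (Phong, Blinn-Phong) or grows
      linearly (Oren-Nayar).

    The intensity is Lipschitz, hence bounded on the bounded set [Omega], and
    the Lipschitz estimate for the product follows ([hamiltonian_lipschitz]). *)

(** * Euclidean geometry of the plane *)

Lemma dotvE (R : realType) (p x : 'rV[R]_2) :
  dotv p x = p ord0 ord0 * x ord0 ord0 + p ord0 ord_max * x ord0 ord_max.
Proof.
rewrite /dotv big_ord_recl big_ord1; congr (_ + p _ _ * x _ _); exact/val_inj.
Qed.

Lemma dotv_ge0 (R : realType) (x : 'rV[R]_2) : 0 <= dotv x x.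
Proof. by rewrite dotvE addr_ge0 // -expr2 sqr_ge0. Qed.

Lemma enorm_ge0 (R : realType) (x : 'rV[R]_2) : 0 <= enorm x.
Proof. exact: sqrtr_ge0. Qed.

Lemma sqr_enorm (R : realType) (x : 'rV[R]_2) : enorm x ^+ 2 = dotv x x.
Proof. by rewrite sqr_sqrtr // dotv_ge0. Qed.

(** The difference of the squares is [(a * d - b * c) ^+ 2]. *)
Lemma cauchy_schwarz (R : realType) (p x : 'rV[R]_2) :
  `|dotv p x| <= enorm p * enorm x.
Proof.
rewrite -(@ler_pXn2r _ 2) ?nnegrE ?mulr_ge0 ?enorm_ge0//.
rewrite exprMn !sqr_enorm real_normK ?num_real// !dotvE.
set a := p _ _; set b := p _ _; set c := x _ _; set d := x _ _.
by have := sqr_ge0 (a * d - b * c); nra.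
Qed.

Lemma dotvBr (R : realType) (p x y : 'rV[R]_2) :
  dotv p (x - y) = dotv p x - dotv p y.
Proof. by rewrite !dotvE !mxE; ring. Qed.

Lemma dotvC (R : realType) (p x : 'rV[R]_2) : dotv p x = dotv x p.
Proof. by rewrite !dotvE; ring. Qed.

Lemma bounded_enorm (R : realType) (A : set 'rV[R]_2) :
  bounded_set A -> exists2 K : R, 0 <= K & forall x, A x -> enorm x <= K.
Proof.
move=> [N [_ /(_ (`|N| + 1))]]; rewrite (le_lt_trans (ler_norm N)) ?ltrDl//.
move=> /(_ isT) AN; exists (2 * (`|N| + 1)); first by rewrite mulr_ge0 ?addr_ge0.
move=> x /AN /= xN; have N0 := normr_ge0 N.
have coord i : `|x ord0 i| <= `|N| + 1.
  apply: le_trans xN; rewrite [leRHS]/Num.norm /= mx_normrE.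
  by apply/bigmax_geP; right => /=; exists (ord0, i).
have x0 := coord ord0; have x1 := coord ord_max.
rewrite -(@ler_pXn2r _ 2) ?nnegrE ?enorm_ge0 ?mulr_ge0 ?addr_ge0//.
rewrite sqr_enorm dotvE -!expr2 -(real_normK (num_real (x ord0 ord0))).
rewrite -(real_normK (num_real (x ord0 ord_max))).
by have := normr_ge0 (x ord0 ord0); have := normr_ge0 (x ord0 ord_max); nra.
Qed.

Lemma lipschitz_bounded (R : realType) (A : set 'rV[R]_2) (g : 'rV[R]_2 -> R) :
  bounded_set A -> lipschitz_in A g ->
  exists2 J : R, 0 <= J & forall x, A x -> `|g x| <= J.
Proof.
move=> /bounded_enorm[K K0 AK] [L L0 gL].
have [[x0 Ax0]|noA] := pselect (exists x, A x); last first.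
  by exists 0 => // x Ax; case: noA; exists x.
have dist x : A x -> enorm (x - x0) <= 2 * K.
  move=> Ax; have := AK _ Ax; have := AK _ Ax0.
  move=> x0K xK; rewrite -(@ler_pXn2r _ 2) ?nnegrE ?enorm_ge0 ?mulr_ge0//.
  have := cauchy_schwarz x x0; rewrite ler_norml => /andP[xx0 _].
  rewrite sqr_enorm dotvBr dotvC dotvBr (dotvC (x - x0)) dotvBr (dotvC x0 x).
  rewrite -!sqr_enorm.
  by have := enorm_ge0 x; have := enorm_ge0 x0; nra.
exists (`|g x0| + L * (2 * K)); first by rewrite addr_ge0 ?mulr_ge0.
move=> x Ax; rewrite -[g x](subrK (g x0)) addrC (le_trans (ler_normD _ _))//.
by rewrite lerD2l (le_trans (gL _ _ Ax Ax0))// ler_wpM2l// dist.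
Qed.

(** * The secant of the incidence angle *)

(** For the surface normal determined by [p] at [x], this is the secant of the
    angle between that normal and the direction of the light: it is the
    Lambertian [F] evaluated at [W f x p]. *)
Definition secant (R : realType) (f : R) (x p : 'rV[R]_2) : R :=
  Num.sqrt (W f x p + 1).

Lemma WE (R : realType) (f : R) (x p : 'rV[R]_2) : 0 < f ->
  W f x p = (f ^+ 2 * enorm p ^+ 2 + dotv p x ^+ 2) * (f ^+ 2 + enorm x ^+ 2)
            / f ^+ 2.
Proof.
move=> f0; rewrite /W /Q expr_div_n (@sqr_sqrtr _ (f ^+ 2 + _)) ?addr_ge0 ?sqr_ge0//.
by rewrite invf_div mulrA.
Qed.

Lemma W_ge (R : realType) (f : R) (x p : 'rV[R]_2) : 0 < f ->
  (f * enorm p) ^+ 2 <= W f x p.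
Proof.
move=> f0; rewrite WE// ler_pdivlMr ?exprn_gt0// exprMn.
have := sqr_ge0 (enorm x); have := sqr_ge0 (dotv p x).
have : 0 <= f ^+ 2 * enorm p ^+ 2 by rewrite mulr_ge0 ?sqr_ge0.
have : 0 <= f ^+ 2 by rewrite sqr_ge0.
by nra.
Qed.

Lemma W_ge0 (R : realType) (f : R) (x p : 'rV[R]_2) : 0 < f -> 0 <= W f x p.
Proof. by move=> f0; rewrite (le_trans _ (W_ge x p f0))// sqr_ge0. Qed.

Lemma sqr_secant (R : realType) (f : R) (x p : 'rV[R]_2) : 0 < f ->
  secant f x p ^+ 2 = W f x p + 1.
Proof. by move=> f0; rewrite sqr_sqrtr// addr_ge0// W_ge0. Qed.

Lemma secant_ge1 (R : realType) (f : R) (x p : 'rV[R]_2) : 0 < f ->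
  1 <= secant f x p.
Proof. by move=> f0; rewrite -sqrtr1 /secant ler_wsqrtr// lerDr W_ge0. Qed.

Lemma secant_ge (R : realType) (f : R) (x p : 'rV[R]_2) : 0 < f ->
  f * enorm p <= secant f x p.
Proof.
move=> f0; have fp0 : 0 <= f * enorm p by rewrite mulr_ge0 ?enorm_ge0 ?ltW.
rewrite -(ger0_norm fp0) -(sqrtr_sqr (f * _)) ler_wsqrtr//.
by rewrite (le_trans (W_ge x p f0))// lerDl.
Qed.

Lemma secant_linear_growth (R : realType) (f K : R) : 0 < f -> 0 <= K ->
  exists2 C : R, 0 <= C &
    forall x p, enorm x <= K -> secant f x p <= C * (1 + enorm p).
Proof.
move=> f0 K0; set c := (f ^+ 2 + K ^+ 2) / f.
have c0 : 0 <= c by rewrite divr_ge0 ?addr_ge0 ?sqr_ge0 ?ltW.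
exists (1 + c) => [|x p xK]; first by rewrite addr_ge0.
have p0 := enorm_ge0 p; have x0 := enorm_ge0 x.
rewrite -(@ler_pXn2r _ 2) ?nnegrE ?sqrtr_ge0 ?mulr_ge0 ?addr_ge0// sqr_secant//.
suff : W f x p <= (c * enorm p) ^+ 2 by have := mulr_ge0 c0 p0; nra.
have -> : (c * enorm p) ^+ 2 =
    enorm p ^+ 2 * (f ^+ 2 + K ^+ 2) * (f ^+ 2 + K ^+ 2) / f ^+ 2.
  by rewrite /c; field; rewrite gt_eqF.
rewrite WE// ler_pM2r ?invr_gt0 ?exprn_gt0//.
have xK2 : enorm x ^+ 2 <= K ^+ 2 by rewrite lerXn2r ?nnegrE.
have px : dotv p x ^+ 2 <= enorm p ^+ 2 * K ^+ 2.
  rewrite -[leLHS]real_normK ?num_real// -exprMn lerXn2r ?nnegrE ?mulr_ge0//.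
  by rewrite (le_trans (cauchy_schwarz p x))// ler_wpM2l.
apply: ler_pM.
- by rewrite addr_ge0 ?sqr_ge0// mulr_ge0 ?sqr_ge0.
- by rewrite addr_ge0// sqr_ge0.
- by rewrite mulrDr [f ^+ 2 * _]mulrC lerD2l.
- by rewrite lerD2l.
Qed.

(** The increment of [W] carries the factor [enorm p ^+ 2]; a single power
    survives because [secant x + secant y] is at least [2 * f * enorm p]. *)
Lemma secant_lipschitz (R : realType) (f K : R) : 0 < f -> 0 <= K ->
  exists2 C : R, 0 <= C & forall x y p, enorm x <= K -> enorm y <= K ->
    `|secant f x p - secant f y p| <= C * enorm p * enorm (x - y).
Proof.
move=> f0 K0; set c := 4 * K * (f ^+ 2 + K ^+ 2) / f ^+ 2.
have c0 : 0 <= c by rewrite divr_ge0 ?sqr_ge0 ?mulr_ge0 ?addr_ge0 ?sqr_ge0.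
exists (c / (2 * f)) => [|x y p xK yK]; first by rewrite divr_ge0// mulr_ge0// ltW.
have p0 := enorm_ge0 p; have e0 := enorm_ge0 (x - y).
have bnd z w : enorm w <= K -> `|dotv z w| <= enorm z * K.
  by move=> wK; rewrite (le_trans (cauchy_schwarz z w))// ler_wpM2l// enorm_ge0.
have sqrK z : enorm z <= K -> enorm z ^+ 2 <= K ^+ 2.
  by move=> zK; rewrite lerXn2r ?nnegrE ?enorm_ge0.
have dW : `|W f x p - W f y p| <= c * enorm p ^+ 2 * enorm (x - y).
  set a := fun z => f ^+ 2 * enorm p ^+ 2 + dotv p z ^+ 2.
  set b := fun z : 'rV[R]_2 => f ^+ 2 + enorm z ^+ 2.
  have da : `|a x - a y| <= 2 * K * enorm p ^+ 2 * enorm (x - y).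
    have -> : a x - a y = dotv p (x - y) * (dotv p x + dotv p y).
      by rewrite dotvBr /a; ring.
    rewrite normrM.
    have -> : 2 * K * enorm p ^+ 2 * enorm (x - y) =
      (enorm p * enorm (x - y)) * (enorm p * K + enorm p * K) by ring.
    by rewrite ler_pM// ?cauchy_schwarz// (le_trans (ler_normD _ _))// lerD// bnd.
  have db : `|b x - b y| <= 2 * K * enorm (x - y).
    have -> : b x - b y = dotv (x - y) x + dotv (x - y) y.
      by rewrite /b !sqr_enorm !dotvE !mxE; ring.
    rewrite (le_trans (ler_normD _ _))//.
    have -> : 2 * K * enorm (x - y) =
      enorm (x - y) * K + enorm (x - y) * K by ring.
    by rewrite lerD// bnd.
  have bx : `|b x| <= f ^+ 2 + K ^+ 2.
    by rewrite ger0_norm ?addr_ge0 ?sqr_ge0// lerD2l sqrK.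
  have ay : `|a y| <= enorm p ^+ 2 * (f ^+ 2 + K ^+ 2).
    have a0 : 0 <= a y by rewrite addr_ge0 ?sqr_ge0// mulr_ge0 ?sqr_ge0.
    rewrite ger0_norm// mulrDr /a [f ^+ 2 * _]mulrC lerD2l.
    rewrite -[leLHS]real_normK ?num_real// -exprMn.
    by rewrite lerXn2r ?nnegrE ?mulr_ge0// bnd.
  have -> : W f x p - W f y p =
      ((a x - a y) * b x + a y * (b x - b y)) / f ^+ 2.
    by rewrite !WE// /a /b; ring.
  rewrite normrM [X in _ * X]ger0_norm ?invr_ge0 ?sqr_ge0//.
  rewrite ler_pdivrMr ?exprn_gt0// (le_trans (ler_normD _ _))// !normrM.
  have -> : c * enorm p ^+ 2 * enorm (x - y) * f ^+ 2 =
    2 * K * enorm p ^+ 2 * enorm (x - y) * (f ^+ 2 + K ^+ 2) +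
    enorm p ^+ 2 * (f ^+ 2 + K ^+ 2) * (2 * K * enorm (x - y)).
    by rewrite /c; field; rewrite gt_eqF.
  by rewrite lerD// ler_pM.
have ST : `|secant f x p - secant f y p| * (secant f x p + secant f y p)
    <= c * enorm p ^+ 2 * enorm (x - y).
  have S0 z : 0 <= secant f z p by exact: sqrtr_ge0.
  rewrite -[X in _ * X]ger0_norm ?addr_ge0// -normrM -subr_sqr !sqr_secant//.
  by rewrite [X in `|X|](_ : _ = W f x p - W f y p)//; ring.
have xS := secant_ge x p f0; have yS := secant_ge y p f0.
have x1 := secant_ge1 x p f0; have y1 := secant_ge1 y p f0.
(* For [p = 0] there is nothing to cancel; instead both secants are positive. *)
have [pn0|pn0] := eqVneq (enorm p) 0.
  move: ST; rewrite pn0 expr0n /= !mulr0 !mul0r.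
  by rewrite pmulr_lle0//; lra.
have pp : 0 < enorm p by rewrite lt_def pn0.
have S2 : 2 * f * enorm p <= secant f x p + secant f y p by lra.
rewrite -(@ler_pM2r _ (2 * f * enorm p)) ?mulr_gt0//.
apply: le_trans (le_trans _ ST) _; first by rewrite ler_wpM2l.
by rewrite le_eqVlt; apply/orP; left; apply/eqP; field; rewrite gt_eqF.
Qed.

(** * Reflectance functions in the secant variable *)

(** The finite-difference form of [`|t * D' t| <= C * D t], a bound on the logarithmic
    derivative of [D] that makes sense when [D] is not differentiable, as
    happens in the Phong model. *)
Definition slowly_varying (R : realType) (D : R -> R) (d C : R) : Prop :=
  [/\ 0 < d, 0 <= C, forall t, 1 <= t -> d <= D t &
      forall s t, 1 <= s -> s <= t -> s * `|D t - D s| <= C * D s * (t - s)].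

Lemma slowly_varying_le (R : realType) (D : R -> R) (d C t : R) :
  slowly_varying D d C -> 1 <= t -> `|t / D t| <= d^-1 * t.
Proof.
move=> [d0 _ dD _] t1; have Dt := dD _ t1.
rewrite ger0_norm; last by rewrite divr_ge0; lra.
by rewrite mulrC ler_wpM2r ?lef_pV2 ?posrE//; lra.
Qed.

(** Formally [(t / D t)' = (1 - t * D' t / D t) / D t], which is bounded by
    [(1 + C) / d]; the proof is the finite-difference version of this. *)
Lemma slowly_varying_lipschitz (R : realType) (D : R -> R) (d C s t : R) :
  slowly_varying D d C -> 1 <= s -> 1 <= t ->
  `|t / D t - s / D s| <= (1 + C) / d * `|t - s|.
Proof.
move=> DdC; wlog st : s t / s <= t => [ih|] s1 t1.
  have [/ih|/ltW /ih] := leP s t; first exact.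
  by rewrite distrC [`|t - s|]distrC; exact.
have [d0 C0 dD Dlip] := DdC.
have Dt := dD _ t1; have Ds := dD _ s1.
have Dt0 := lt_le_trans d0 Dt; have Ds0 := lt_le_trans d0 Ds.
rewrite [in leRHS]ger0_norm ?subr_ge0//.
have -> : t / D t - s / D s = ((t - s) - s * (D t - D s) / D s) / D t.
  by field; rewrite !gt_eqF.
rewrite normrM [`|(D t)^-1|]ger0_norm ?invr_ge0 ?(ltW Dt0)// [leRHS]mulrAC.
have num : `|(t - s) - s * (D t - D s) / D s| <= (1 + C) * (t - s).
  rewrite (le_trans (ler_normB _ _))// mulrDl mul1r lerD//.
    by rewrite ger0_norm ?subr_ge0.
  rewrite !normrM [`|s|]ger0_norm ?(le_trans ler01)//.
  rewrite [`|(D s)^-1|]ger0_norm ?invr_ge0 ?(ltW Ds0)// ler_pdivrMr//.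
  rewrite [leRHS]mulrAC.
  exact: Dlip.
by apply: ler_pM => //; rewrite ?invr_ge0 ?(ltW Dt0)// lef_pV2.
Qed.

(** Here [D] grows linearly, so that its increments must be compared with [D]
    itself: [t * D' t = B * (t + t^-1)] exceeds [D t] by at most [2 * B]. *)
Lemma oren_nayar_slowly_varying (R : realType) (A B : R) :
  0 < A -> 0 <= B ->
  slowly_varying (fun t => A + B * (t - t^-1)) A (1 + 2 * B / A).
Proof.
move=> A0 B0.
have C0 : 0 <= 2 * B / A by rewrite divr_ge0 ?mulr_ge0// ltW.
have inv1 (t : R) : 1 <= t -> 0 < t^-1 <= 1.
  by move=> t1; rewrite invr_gt0 invf_le1 (lt_le_trans ltr01).
split=> // [|t t1|s t s1 st]; first by rewrite addr_ge0.
  by have /andP[_ ?] := inv1 _ t1; rewrite lerDl mulr_ge0//; lra.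
have t1 := le_trans s1 st.
have /andP[si0 si1] := inv1 _ s1; have /andP[ti0 ti1] := inv1 _ t1.
have -> : A + B * (t - t^-1) - (A + B * (s - s^-1)) =
    B * (1 + s^-1 * t^-1) * (t - s).
  by field; rewrite !gt_eqF//; lra.
rewrite ger0_norm; last by rewrite mulr_ge0 ?subr_ge0// mulr_ge0// addr_ge0// mulr_ge0// ltW.
rewrite mulrA ler_wpM2r ?subr_ge0//.
have -> : s * (B * (1 + s^-1 * t^-1)) = B * (s + t^-1).
  by field; rewrite !gt_eqF//; lra.
have BA : 2 * B = 2 * B / A * A by field; rewrite gt_eqF.
have : B * (s + t^-1) <= B * (s - s^-1) + 2 * B.
  by rewrite -[2 * B]mulrC -mulrDr ler_wpM2l//; lra.
have : 0 <= 2 * B / A * (B * (s - s^-1)) by rewrite mulr_ge0// mulr_ge0//; lra.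
by nra.
Qed.

(** The exponent [a] is real, so the increment of [t `^ (- a)] is bounded
    through the exponential: [(t / s) `^ (- a) >= 1 - a * ln (t / s)] and
    [ln (t / s) <= t / s - 1]. *)
Lemma blinn_phong_slowly_varying (R : realType) (kD kS a : R) :
  0 < kD -> 0 <= kS -> 0 <= a ->
  slowly_varying (fun t => kD + kS * t `^ (- a)) kD (kS * a / kD).
Proof.
move=> D0 S0 a0.
split=> // [|t t1|s t s1 st]; first by rewrite divr_ge0 ?(ltW D0)// mulr_ge0.
  by rewrite lerDl mulr_ge0 ?powR_ge0.
have s0 : 0 < s by lra.
have t0 : 0 < t by lra.
have lnst : ln t - ln s <= t / s - 1.
  rewrite -ln_div ?posrE// -[X in ln X](subrKC 1) le_ln1Dx//.
  by rewrite ltrBrDl subrr divr_gt0.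
have sa1 : s `^ (- a) <= 1.
  by rewrite -(powRr0 s) ler_powR// oppr_le0.
have sa0 := powR_gt0 (- a) s0.
have q : 1 - a * (t / s - 1) <= t `^ (- a) / s `^ (- a).
  rewrite /powR !gt_eqF// -expRN -expRD (le_trans _ (expR_ge1Dx _))//.
  by have := ler_wpM2l a0 lnst; lra.
have mono : t `^ (- a) <= s `^ (- a).
  rewrite !powRN lef_pV2 ?posrE ?powR_gt0//.
  by rewrite ge0_ler_powR ?nnegrE ?(ltW s0) ?(ltW t0).
have key : s * (s `^ (- a) - t `^ (- a)) <= a * (t - s).
  have -> : s `^ (- a) - t `^ (- a) =
      s `^ (- a) * (1 - t `^ (- a) / s `^ (- a)).
    by field; rewrite gt_eqF.
  have q1 : t `^ (- a) / s `^ (- a) <= 1 by rewrite ler_pdivrMr// mul1r.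
  have le1 : s * (1 - t `^ (- a) / s `^ (- a)) <= s * (a * (t / s - 1)).
    by rewrite ler_wpM2l ?(ltW s0)//; lra.
  have -> : a * (t - s) = s * (a * (t / s - 1)) by field; rewrite gt_eqF.
  apply: le_trans le1; rewrite ler_wpM2l ?(ltW s0)//.
  by rewrite ler_piMl//; lra.
have -> : kD + kS * t `^ (- a) - (kD + kS * s `^ (- a)) =
  - (kS * (s `^ (- a) - t `^ (- a))) by ring.
rewrite normrN ger0_norm; last by rewrite mulr_ge0//; lra.
have := ler_wpM2l S0 key.
have -> : kS * a / kD * (kD + kS * s `^ (- a)) * (t - s) =
  kS * (a * (t - s)) + kS * a / kD * (kS * s `^ (- a)) * (t - s).
  by field; rewrite gt_eqF.
have : 0 <= kS * a / kD * (kS * s `^ (- a)) * (t - s).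
  by rewrite mulr_ge0 ?subr_ge0// mulr_ge0 ?divr_ge0 ?mulr_ge0// ltW.
by lra.
Qed.

(** For [n = alpha - 1] this is the specular term
    [(r + 1) `^ (1 / 2) * (1 - r) ^+ alpha / (r + 1) ^+ alpha] of the Phong
    model, with [r + 1 = t ^+ 2] and [1 - r] truncated to its positive part.
    Since [(1 - r) / (r + 1) = 2 / t ^+ 2 - 1], one of the [alpha] factors
    absorbs [t] and becomes [2 / t - t]; both factors then lie
    between [0] and [1] for [1 <= t].  The truncation merges the two cases in the
    definition of the Phong reflectance. *)
Definition phong_lobe (R : realType) (n : nat) (t : R) : R :=
  Num.max 0 (2 / t - t) * Num.max 0 (2 / t ^+ 2 - 1) ^+ n.

Lemma expr_lipschitz (R : realType) (n : nat) (u v : R) :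
  0 <= u <= 1 -> 0 <= v <= 1 -> `|u ^+ n - v ^+ n| <= n%:R * `|u - v|.
Proof.
move=> /andP[u0 u1] /andP[v0 v1]; elim: n => [|n ih].
  by rewrite !expr0 subrr normr0 mul0r.
have -> : u ^+ n.+1 - v ^+ n.+1 = u * (u ^+ n - v ^+ n) + (u - v) * v ^+ n.
  by rewrite !exprS; ring.
rewrite (le_trans (ler_normD _ _))// !normrM [`|u|]ger0_norm//.
rewrite [`|v ^+ n|]ger0_norm ?exprn_ge0//.
have := exprn_ile1 n v0 v1; have := exprn_ge0 n v0.
have := normr_ge0 (u ^+ n - v ^+ n); have := normr_ge0 (u - v).
by rewrite -natr1; nra.
Qed.

Lemma max0_lipschitz (R : realType) (u v : R) :
  `|Num.max 0 u - Num.max 0 v| <= `|u - v|.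
Proof.
have := ler_norm (u - v); have := ler_norm (v - u).
rewrite [`|v - u|]distrC ler_norml.
by have [u0|u0] := leP 0 u; have [v0|v0] := leP 0 v; lra.
Qed.

Lemma phong_lobe_lipschitz (R : realType) (n : nat) (s t : R) :
  1 <= s -> s <= t ->
  `|phong_lobe n t - phong_lobe n s| <= (3 + 4 * n%:R) * (t - s).
Proof.
move=> s1 st; have t1 := le_trans s1 st.
have inv1 (u : R) : 1 <= u -> 0 < u^-1 <= 1.
  by move=> u1; rewrite invr_gt0 invf_le1 (lt_le_trans ltr01).
have /andP[si0 si1] := inv1 _ s1; have /andP[ti0 ti1] := inv1 _ t1.
pose k := fun t : R => Num.max 0 (2 / t - t).
pose h := fun t : R => Num.max 0 (2 / t ^+ 2 - 1).
have k01 u : 1 <= u -> 0 <= k u <= 1.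
  move=> u1; have /andP[_ ui] := inv1 _ u1.
  by rewrite /k le_max lexx ge_max ler01 /=; lra.
have h01 u : 1 <= u -> 0 <= h u <= 1.
  move=> u1; have := inv1 (u ^+ 2) (exprn_ege1 2 u1) => /andP[_ ui].
  by rewrite /h le_max lexx ge_max ler01 /=; lra.
have dk : `|k t - k s| <= 3 * (t - s).
  rewrite (le_trans (max0_lipschitz _ _))//.
  (* [s^-1 * t^-1 <= 1], which gives the constant [1 + 2]. *)
  have -> : 2 / t - t - (2 / s - s) = - ((1 + 2 * (s^-1 * t^-1)) * (t - s)).
    by field; rewrite !gt_eqF//; lra.
  have : s^-1 * t^-1 <= 1 by rewrite mulr_ile1 ?(ltW si0) ?(ltW ti0).
  have st0 : 0 < s^-1 * t^-1 by rewrite mulr_gt0.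
  rewrite normrN ger0_norm; last by rewrite mulr_ge0//; lra.
  by move=> ?; rewrite ler_wpM2r ?subr_ge0//; lra.
have dh : `|h t - h s| <= 4 * (t - s).
  rewrite (le_trans (max0_lipschitz _ _))//.
  (* Here the product of [s^-1 * t^-1] and [s^-1 + t^-1] is at most [2]. *)
  have -> : 2 / t ^+ 2 - 1 - (2 / s ^+ 2 - 1) =
     - (2 * (s^-1 * t^-1) * (s^-1 + t^-1) * (t - s)).
    by field; rewrite !gt_eqF//; lra.
  have : s^-1 * t^-1 <= 1 by rewrite mulr_ile1 ?(ltW si0) ?(ltW ti0).
  have st0 : 0 < s^-1 * t^-1 by rewrite mulr_gt0.
  rewrite normrN ger0_norm; last by rewrite !mulr_ge0//; lra.
  by move=> ?; rewrite ler_wpM2r ?subr_ge0//; nra.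
change (`|k t * h t ^+ n - k s * h s ^+ n| <= (3 + 4 * n%:R) * (t - s)).
have -> : k t * h t ^+ n - k s * h s ^+ n =
  (k t - k s) * h t ^+ n + k s * (h t ^+ n - h s ^+ n) by ring.
have /andP[ks0 ks1] := k01 _ s1; have /andP[ht0 ht1] := h01 _ t1.
rewrite [leRHS]mulrDl (le_trans (ler_normD _ _))// lerD// normrM.
  rewrite -[leRHS]mulr1 ler_pM// ger0_norm ?exprn_ge0//.
  exact: exprn_ile1.
rewrite -[leRHS]mul1r ler_pM//; first by rewrite ger0_norm.
rewrite (le_trans (expr_lipschitz _ (h01 _ t1) (h01 _ s1)))//.
by rewrite [4 * _]mulrC -mulrA ler_wpM2l.
Qed.

(** The factor [s] in [slowly_varying] is harmless because the lobe vanishes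
    beyond [s = 2] (in fact beyond [Num.sqrt 2]). *)
Lemma phong_slowly_varying (R : realType) (kD kS : R) (n : nat) :
  0 < kD -> 0 <= kS ->
  slowly_varying (fun t => kD + kS * phong_lobe n t) kD
    (2 * kS * (3 + 4 * n%:R) / kD).
Proof.
move=> D0 S0.
have lobe0 (t : R) : 0 <= phong_lobe n t.
  by rewrite mulr_ge0 ?exprn_ge0// le_max lexx.
have C0 : 0 <= 2 * kS * (3 + 4 * n%:R) by rewrite !mulr_ge0 ?addr_ge0 ?mulr_ge0.
have lobe_eq0 (t : R) : 2 < t -> phong_lobe n t = 0.
  move=> t2; rewrite /phong_lobe max_l ?mul0r// subr_le0 ler_pdivrMr; nra.
split=> // [|t t1|s t s1 st]; first by rewrite divr_ge0// ltW.
  by rewrite lerDl mulr_ge0.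
have -> : kD + kS * phong_lobe n t - (kD + kS * phong_lobe n s) =
  kS * (phong_lobe n t - phong_lobe n s) by ring.
have ts : 0 <= t - s by rewrite subr_ge0.
have [s2|s2] := leP s 2; last first.
  rewrite !lobe_eq0//; last by lra.
  rewrite subrr mulr0 normr0 mulr0 mulr_ge0// mulr_ge0 ?divr_ge0//.
    by rewrite ltW.
  by rewrite addr_ge0 ?mulr_ge0// ltW.
rewrite normrM [`|kS|]ger0_norm//.
have := ler_wpM2l S0 (phong_lobe_lipschitz n s1 st).
set X := kS * `|_| => XL.
have X0 : 0 <= X by rewrite mulr_ge0.
have : s * X <= 2 * kS * (3 + 4 * n%:R) * (t - s).
  rewrite -!mulrA; apply: ler_pM => //; exact: le_trans ler01 s1.
move=> /le_trans; apply; rewrite ler_wpM2r//.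
by rewrite [leRHS]mulrAC ler_pdivlMr// ler_wpM2l// lerDl mulr_ge0.
Qed.

Definition reflectance_denominator (R : realType) (M : model R) : R -> R :=
  match M with
  | Lambert => fun=> 1
  | OrenNayar sigma => fun t => ON_A sigma + ON_B sigma * (t - t^-1)
  | Phong _ kD kS alpha => fun t => kD + kS * phong_lobe alpha.-1 t
  | BlinnPhong _ kD kS c => fun t => kD + kS * t `^ (- (c - 1))
  end.

Lemma ON_A_gt0 (R : realType) (sigma : R) : 0 < ON_A sigma.
Proof.
by have s0 := sqr_ge0 sigma; rewrite /ON_A subr_gt0 ltr_pdivrMr; lra.
Qed.

Lemma ON_B_ge0 (R : realType) (sigma : R) : 0 <= ON_B sigma.
Proof. by have s0 := sqr_ge0 sigma; rewrite divr_ge0//; lra. Qed.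

Lemma reflectance_denominator_slowly_varying (R : realType) (M : model R) :
  admissible M ->
  exists d C : R, slowly_varying (reflectance_denominator M) d C.
Proof.
case: M => [|sigma|kA kD kS alpha|kA kD kS c] /=.
- move=> _; exists 1, 0; split => // s t s1 st.
  by rewrite subrr normr0 mulr0 !mul0r.
- move=> _; do 2 eexists; apply: oren_nayar_slowly_varying.
    exact: ON_A_gt0.
  exact: ON_B_ge0.
- move=> [[_ D0 S0 _] _]; do 2 eexists; exact: phong_slowly_varying.
- move=> [[_ D0 S0 _] c1]; do 2 eexists; apply: blinn_phong_slowly_varying => //.
  by rewrite subr_ge0.
Qed.

(** Dividing numerator and denominator by the common powers of
    [t = Num.sqrt (r + 1)] leaves [t] alone in the numerator in every model. *)
Lemma F_secant (R : realType) (M : model R) (t : R) : admissible M -> 1 <= t ->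
  F M (t ^+ 2 - 1) = t / reflectance_denominator M t.
Proof.
move=> adm t1; have t0 : 0 < t by lra.
have tn0 : t != 0 by rewrite gt_eqF.
have st : Num.sqrt (t ^+ 2) = t by rewrite sqrtr_sqr gtr0_norm.
case: M adm => [|sigma|kA kD kS alpha|kA kD kS c] /=; rewrite subrK ?st.
- by rewrite divr1.
- have A0 := ON_A_gt0 sigma; have B0 := ON_B_ge0 sigma => _.
  have [? _ dD _] := oren_nayar_slowly_varying A0 B0.
  have ? := dD _ t1.
  rewrite [in RHS](_ : _ + _ = (ON_A sigma * t + ON_B sigma * (t ^+ 2 - 1)) / t).
    by rewrite invf_div mulrA -expr2.
  by field.
- move=> [[_ D0 S0 _] alpha1].
  case: alpha alpha1 => // n _ /=; rewrite /phong_lobe.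
  have [t2|t2] := leP 1 (t ^+ 2 - 1).
    rewrite [Num.max 0 (2 / t - t)]max_l ?mul0r ?mulr0 ?addr0//.
    by rewrite subr_le0 ler_pdivrMr//; lra.
  rewrite !max_r; last 2 first.
  + by rewrite subr_ge0 ler_pdivlMr ?exprn_gt0//; lra.
  + by rewrite subr_ge0 ler_pdivlMr//; lra.
  have half : (t ^+ 2) `^ (1 / 2) = t by rewrite mul1r powR12_sqrt ?sqr_ge0.
  have t2n0 : t ^+ 2 != 0 by rewrite expf_neq0.
  rewrite powRD ?t2n0 ?implybT// powR_mulrn ?sqr_ge0// half.
  set N := (t ^+ 2) ^+ n.+1.
  have N0 : 0 < N by rewrite !exprn_gt0.
  have lobe : kS * t * (1 - (t ^+ 2 - 1)) ^+ n.+1 =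
      N * (kS * ((2 / t - t) * (2 / t ^+ 2 - 1) ^+ n)).
    have -> : 2 / t - t = t * (2 / t ^+ 2 - 1) by field.
    have -> : 1 - (t ^+ 2 - 1) = t ^+ 2 * (2 / t ^+ 2 - 1) by field.
    by rewrite exprMn -/N exprS; ring.
  rewrite lobe [kD * N]mulrC -mulrDr.
  by rewrite [N * t]mulrC invfM mulrA mulfK// gt_eqF.
- move=> [[_ D0 S0 _] c1].
  have pw u : (t ^+ 2) `^ (u / 2) = t `^ u.
    by rewrite -powR_mulrn ?(ltW t0)// -powRrM mulrC divfK.
  have tc : t `^ c = t * t `^ (c - 1).
    rewrite -[X in X * _]powRr1 ?(ltW t0)// -powRD ?tn0 ?implybT//.
    by rewrite addrC subrK.
  rewrite !pw tc powRN.
  have w0 := powR_gt0 (c - 1) t0; have w1 := powR_ge0 t (c - 1).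
  have E : 0 < kD * t `^ (c - 1) + kS by rewrite ltr_wpDr// mulr_gt0.
  by field; rewrite !gt_eqF.
Qed.

(** * The structure conditions *)

(** Factor out [expR (- (2 * u))] and use convexity, [1 + z <= expR z]. *)
Lemma expR_gap (R : realType) (rho u v : R) :
  v <= u -> u <= rho ->
  2 * expR (- (2 * rho)) * (u - v) <= expR (- (2 * v)) - expR (- (2 * u)).
Proof.
move=> vu urho.
have -> : - (2 * v) = - (2 * u) + 2 * (u - v) by ring.
rewrite expRD -[X in _ <= _ - X](mulr1 _) -mulrBr.
have le1 : 2 * (u - v) <= expR (2 * (u - v)) - 1.
  by have := expR_ge1Dx (2 * (u - v)); lra.
rewrite [2 * _]mulrC -mulrA ler_pM ?expR_ge0//; last by rewrite ler_expR; lra.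
by rewrite mulr_ge0// subr_ge0.
Qed.

(** The exponential terms cancel, and the increment of the product
    [i * F] splits as [(i x - i y) * F x + i y * (F x - F y)]: the first part
    uses the linear growth of [F] in [p], the second the boundedness of [i]. *)
Lemma hamiltonian_lipschitz (R : realType) (Omega : set 'rV[R]_2) (f : R)
    (M : model R) (I IA : 'rV[R]_2 -> R) :
  bounded_set Omega -> 0 < f -> admissible M ->
  lipschitz_in Omega (eff_intensity M I IA) ->
  exists2 C : R, 0 <= C & forall x y u p, Omega x -> Omega y ->
    `|hamiltonian M f I IA x u p - hamiltonian M f I IA y u p|
      <= C * (enorm (x - y) * (1 + enorm p)).
Proof.
move=> bnd f0 adm Ilip.
have [K K0 OK] := bounded_enorm bnd.
have [J J0 IJ] := lipschitz_bounded bnd Ilip.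
have [L L0 IL] := Ilip.
have [d [C DdC]] := reflectance_denominator_slowly_varying adm.
have [G G0 SG] := secant_linear_growth f0 K0.
have [E E0 SE] := secant_lipschitz f0 K0.
have [d0 C0 _ _] := DdC.
have Fs x p : F M (W f x p) =
    secant f x p / reflectance_denominator M (secant f x p).
  by rewrite -F_secant// ?secant_ge1// sqr_secant// addrK.
set c1 := d^-1 * G; set c2 := (1 + C) / d * E.
have c10 : 0 <= c1 by rewrite mulr_ge0 ?invr_ge0// ltW.
have c20 : 0 <= c2 by rewrite mulr_ge0// divr_ge0 ?addr_ge0// ltW.
exists (f ^+ 2 * (L * c1 + J * c2)).
  by rewrite mulr_ge0 ?sqr_ge0// addr_ge0// mulr_ge0.
move=> x y u p Ox Oy; rewrite /hamiltonian.
have e0 := enorm_ge0 (x - y); have p0 := enorm_ge0 p.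
set i := eff_intensity M I IA.
have Fle : `|F M (W f x p)| <= c1 * (1 + enorm p).
  rewrite Fs (le_trans (slowly_varying_le DdC (secant_ge1 _ _ f0)))//.
  by rewrite -mulrA ler_wpM2l ?invr_ge0 ?(ltW d0)// SG// OK.
have Flip : `|F M (W f x p) - F M (W f y p)| <=
    c2 * (enorm (x - y) * (1 + enorm p)).
  rewrite !Fs.
  rewrite (le_trans (slowly_varying_lipschitz DdC _ _))// ?secant_ge1//.
  rewrite /c2 -[leRHS]mulrA ler_wpM2l ?divr_ge0 ?addr_ge0 ?(ltW d0)//.
  rewrite (le_trans (SE x y p (OK _ Ox) (OK _ Oy)))// -mulrA ler_wpM2l//.
  by rewrite mulrC ler_wpM2l// lerDr.
have -> : - expR (- (2 * u)) + i x * f ^+ 2 * F M (W f x p) -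
    (- expR (- (2 * u)) + i y * f ^+ 2 * F M (W f y p)) =
  f ^+ 2 * ((i x - i y) * F M (W f x p) +
            i y * (F M (W f x p) - F M (W f y p))) by ring.
rewrite normrM [`|f ^+ 2|]ger0_norm ?sqr_ge0// -mulrA ler_wpM2l ?sqr_ge0//.
rewrite (le_trans (ler_normD _ _))// !normrM mulrDl lerD//.
  rewrite [leRHS](_ : _ = (L * enorm (x - y)) * (c1 * (1 + enorm p))); last by ring.
  by rewrite ler_pM// IL.
by rewrite -mulrA ler_pM// IJ.
Qed.

Theorem proposition4p1 (R : realType) (Omega : set 'rV[R]_2) (f : R)
    (M : model R) (I IA : 'rV[R]_2 -> R)
    (Omega_open : open Omega)
    (Omega_bounded : bounded_set Omega)
    (f_gt0 : 0 < f)
    (M_admissible : admissible M)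
    (I_lipschitz : lipschitz_in (closure Omega) (eff_intensity M I IA))
    (I_boundary : exists (delta : R) (Gamma : set 'rV[R]_2),
        [/\ 0 < delta, set_nbhs (boundary Omega) Gamma &
            forall x, Gamma x -> closure Omega x ->
              delta <= eff_intensity M I IA x]) :
  H1 Omega (hamiltonian M f I IA) /\ H2 Omega (hamiltonian M f I IA).
Proof.
split=> rho rho0.
  exists (2 * expR (- (2 * rho))); first by rewrite mulr_gt0 ?expR_gt0.
  move=> x u v p _ _ vu urho; rewrite /hamiltonian.
  by rewrite opprD opprK addrACA subrr addr0 addrC expR_gap.
have Ilip : lipschitz_in Omega (eff_intensity M I IA).
  have [L L0 IL] := I_lipschitz; exists L => // x y Ox Oy.
  by apply: IL; exact: subset_closure.
have [C _ HC] :=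
  hamiltonian_lipschitz Omega_bounded f_gt0 M_admissible Ilip.
exists (fun t => C * t); last by move=> x y u p Ox Oy _ _; exact: HC.
rewrite -[X in _ --> X](mulr0 C); apply: cvgM; [exact: cvg_cst|exact: cvg_id].
Qed.
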